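(* (1) For $n=10$, both trees $A_{10}$ and $B_{10}$ maximize the Wiener index in $\mathfrak{T}_{10}(5)$, i.e. $W(A_{10})=W(B_{10})=\max\{W(T):T\in\mathfrak{T}_{10}(5)\}$. (2) For $n=11$, both trees $A_{11}$ and $C_{11}$ maximize the Wiener index in $\mathfrak{T}_{11}(6)$, i.e. $W(A_{11})=W(C_{11})=\max\{W(T):T\in\mathfrak{T}_{11}(6)\}$. (3) For $n\geq 12$, $A_n$ uniquely (up to isomorphism) maximizes the Wiener index in $\mathfrak{T}_n(n-5)$.
   Context: All graphs are finite, connected, undirected, without loops or parallel edges. The Wiener index $W(G)$ of a graph $G$ is the sum of the distances between all unordered pairs of vertices of $G$. $\mathfrak{T}_n(d)$ denotes the family of all trees on $n$ vertices with diameter $d$. For $n\ge 10$, let $P: v_0v_1\cdots v_{n-5}$ be a path on $n-4$ vertices. $A_n$ is the tree on $n$ vertices obtained from $P$ by attaching two new pendant vertices to $v_1$ and two new pendant vertices to $v_{n-6}$. $B_n$ is the tree on $n$ vertices obtained from $P$ by attaching one new pendant vertex to $v_1$, one new pendant vertex to $v_{n-6}$, and adding two new vertices $x,y$ with edges $v_2x$ and $xy$. For $n\ge 11$, $C_n$ is the tree on $n$ vertices obtained from $P$ by attaching one new pendant vertex to $v_{n-6}$ and adding three new vertices $x,y,z$ with edges $v_3x$, $xy$ and $yz$. *)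

(* Defs.v *)
From mathcomp Require Import all_boot.

Set Implicit Arguments.
Unset Strict Implicit.
Unset Printing Implicit Defensive.

(* Finite undirected graphs without loops or parallel edges; connectedness is
   required in [is_tree]. *)
Record sgraph := SGraph {
  vertex :> finType;
  adj : rel vertex;
  adj_sym : symmetric adj;
  adj_irr : irreflexive adj
}.

Definition walk_of_length (G : sgraph) (x y : G) (k : nat) : bool :=
  [exists p : k.-tuple G, path (@adj G) x p && (last x p == y)].

(* The least k < #|G| such that some walk of length k joins x to y; it exists
   whenever x and y are connected. Otherwise the value is #|G|. *)
Definition dist (G : sgraph) (x y : G) : nat :=
  find (walk_of_length x y) (iota 0 #|G|).

Definition diameter (G : sgraph) : nat :=
  \max_(x : G) \max_(y : G) dist x y.

(* Comparing ranks in the enumeration of the vertices selects each unordered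
   pair of distinct vertices exactly once. *)
Definition wiener (G : sgraph) : nat :=
  \sum_(x : G) \sum_(y : G | enum_rank x < enum_rank y) dist x y.

Definition connected (G : sgraph) : Prop :=
  forall x y : G, connect (@adj G) x y.

Definition acyclic (G : sgraph) : Prop :=
  forall c : seq G, 2 < size c -> ~ ucycle (@adj G) c.

Definition is_tree (G : sgraph) : Prop :=
  [/\ 0 < #|G|, connected G & acyclic G].

Definition isomorphic (G H : sgraph) : Prop :=
  exists2 f : G -> H, bijective f & forall x y : G, adj (f x) (f y) = adj x y.

Definition tree_family (n d : nat) (G : sgraph) : Prop :=
  [/\ is_tree G, #|G| = n & diameter G = d].

Definition maximizes_wiener (n d : nat) (G : sgraph) : Prop :=
  tree_family n d G /\
  forall T : sgraph, tree_family n d T -> wiener T <= wiener G.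

Section GraphOfEdges.
Variables (n : nat) (E : seq (nat * nat)).

Definition edge_rel : rel 'I_n := fun i j =>
  (i != j) && (((i : nat, j : nat) \in E) || ((j : nat, i : nat) \in E)).

Lemma edge_rel_sym : symmetric edge_rel.
Proof. by move=> i j; rewrite /edge_rel eq_sym orbC. Qed.

Lemma edge_rel_irr : irreflexive edge_rel.
Proof. by move=> i; rewrite /edge_rel eqxx. Qed.

Definition graph_of_edges : sgraph := SGraph edge_rel_sym edge_rel_irr.

End GraphOfEdges.

(* In the trees below the vertex v_i is the ordinal i, for i <= n - 5, and the
   four added vertices are n - 4, ..., n - 1. *)
Definition path_edges (n : nat) : seq (nat * nat) :=
  [seq (i, i.+1) | i <- iota 0 (n - 5)].

(* Meaningful for n >= 10. *)
Definition treeA (n : nat) : sgraph :=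
  graph_of_edges n (path_edges n ++
    [:: (1, n - 4); (1, n - 3); (n - 6, n - 2); (n - 6, n - 1)]).

(* Meaningful for n >= 10; x = n - 2 and y = n - 1. *)
Definition treeB (n : nat) : sgraph :=
  graph_of_edges n (path_edges n ++
    [:: (1, n - 4); (n - 6, n - 3); (2, n - 2); (n - 2, n - 1)]).

(* Meaningful for n >= 11; x = n - 3, y = n - 2 and z = n - 1. *)
Definition treeC (n : nat) : sgraph :=
  graph_of_edges n (path_edges n ++
    [:: (n - 6, n - 4); (3, n - 3); (n - 3, n - 2); (n - 2, n - 1)]).

(* Main.v *)
(** Let [v_0, ..., v_d] be a diametral path of a tree on [d + 5] vertices. Each of
the four other vertices [u] hangs at some height [h u <= min(a u, d - a u)] above
[v_(a u)], so that [dist u v_j = h u + |a u - j|], and the distances from [u] to the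
path add up to a constant plus [(d + 1) h u - a u (d - a u)]. It remains to bound the
sum of these four quantities and of the six mutual distances of the four vertices.
A vertex of height at least two has a parent among the four, with the same [a];
sorting the vertices by height leaves 24 choices of parents, and in each of them
[a u (d - a u) >= h (d - h)] for the heights [h] above [v_(a u)] and the triangle
inequality make the bound [4 d + 12] a linear problem. For [d >= 7] equality forces
four leaves, two at [v_1] and two at [v_(d-1)], and all distances are then those of
[treeA], so that the tree is isometric, hence isomorphic, to it. *)

Require Import Defs.
From mathcomp Require Import all_boot zify.

Set Implicit Arguments.
Unset Strict Implicit.
Unset Printing Implicit Defensive.

(** One of the two truncated differences vanishes, so this is the absolute value of [i - j]. *)
Definition gap (i j : nat) : nat := (i - j) + (j - i).

(** * The numerical inequality for four vertices hanging on a path *)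

Section FourVertices.
Variables (T : Type) (D : T -> T -> nat) (h a : T -> nat) (d : nat).

Definition parent_of (x y : T) := [/\ h y = (h x).+1, a y = a x & D x y = 1].

Hypothesis D_le : forall x y, D x y <= h x + h y + gap (a x) (a y).
Hypothesis D_sym : forall x y, D x y = D y x.
Hypothesis D_tri : forall y x z, D x z <= D x y + D y z.
Hypothesis h_le : forall x, h x <= a x /\ a x + h x <= d.

(** Up to a constant, [E] is what the four vertices add to the Wiener index, with the negative
    products [a * (d - a)] moved into [B]. The threshold 7 is sharp: [treeB 10] and [treeC 11] reach
    equality with [d] equal to 5 and 6, and have vertices of height above one. *)
Lemma four_vertices_bound x1 x2 x3 x4 :
  5 <= d ->
  h x1 = 1 -> h x1 <= h x2 -> h x2 <= h x3 -> h x3 <= h x4 ->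
  (h x2 = 1 \/ parent_of x1 x2) ->
  [\/ h x3 = 1, parent_of x1 x3 | parent_of x2 x3] ->
  [\/ h x4 = 1, parent_of x1 x4, parent_of x2 x4 | parent_of x3 x4] ->
  let E := (h x1 + h x2 + h x3 + h x4) * d.+1 +
     (D x1 x2 + D x1 x3 + D x1 x4 + D x2 x3 + D x2 x4 + D x3 x4) in
  let B := 4 * d + 12 + (a x1 * (d - a x1) + a x2 * (d - a x2) +
    a x3 * (d - a x3) + a x4 * (d - a x4)) in
  E <= B /\ (7 <= d -> B <= E -> [/\ h x2 = 1, h x3 = 1 & h x4 = 1]).
Proof.
move=> d5 h1 h12 h23 h34.
(* The next inequality is concavity of [Q] between [h] and [d - h]. Generalizing over [Q] later
   discards its body, so that the products become atoms for [lia]. *)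
pose Q n := n * (d - n).
have Hh x : [/\ h x * (d - h x) <= Q (a x), h x <= a x & a x + h x <= d].
  by have [? ?] := h_le x; split=> //; rewrite /Q; nia.
have [q1 l1 r1] := Hh x1; have [q2 l2 r2] := Hh x2.
have [q3 l3 r3] := Hh x3; have [q4 l4 r4] := Hh x4.
have := (D_le x1 x2, D_le x1 x3, D_le x1 x4, D_le x2 x3, D_le x2 x4, D_le x3 x4).
have := (D_tri x1 x2 x3, D_tri x1 x2 x4, D_tri x1 x3 x4,
  D_tri x2 x1 x3, D_tri x2 x1 x4, D_tri x2 x3 x4).
have := (D_tri x3 x1 x2, D_tri x3 x1 x4, D_tri x3 x2 x4).
rewrite /parent_of -![_ * (d - _)]/(Q _) /gap !(D_sym x2 x1) !(D_sym x3 x1) !(D_sym x3 x2).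
move: (D x1 x2) (D x1 x3) (D x1 x4) (D x2 x3) (D x2 x4) (D x3 x4).
clear D_le D_sym D_tri h_le Hh; move: Q (a x1) (a x2) (a x3) (a x4) (h x1) (h x2) (h x3) (h x4)
  h1 h12 h23 h34 q1 l1 r1 q2 l2 r2 q3 l3 r3 q4 l4 r4.
move=> Q a1 a2 a3 a4 h1 h2 h3 h4 -> h12 h23 h34.
move=> q1 l1 r1 q2 l2 r2 q3 l3 r3 q4 l4 r4 D12 D13 D14 D23 D24 D34.
case=> [[t1 t2] t3] [[[[[t4 t5] t6] t7] t8] t9] [[[[[b12 b13] b14] b23] b24] b34].
move=> P2 P3 P4; set E := _ + _; set B := 4 * d + _ + _ => /=.
(* The equality clause in contrapositive form, a strict linear inequality whenever some height is
   above one. *)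
suff [c1 c2] : E <= B /\ (7 <= d -> (h2 != 1) || (h3 != 1) || (h4 != 1) -> E < B).
  split=> // /c2 {}c2 le_BE; move: le_BE c2; rewrite leqNgt => /negPf ->.
  by case: (h2 =P 1) (h3 =P 1) (h4 =P 1) => [-> |_] [-> |_] [-> |_] // /(_ isT).
rewrite /E /B; clear E B.
(* After substitution every height is a numeral from 1 to 4, so the products with [d] are linear. *)
case: P2 => [?|[? ? ?]]; case: P3 => [?|[? ? ?]|[? ? ?]];
 case: P4 => [?|[? ? ?]|[? ? ?]|[? ? ?]]; subst; try (by []); split; try (by []).
all: lia.
Qed.

End FourVertices.

(** * Distance as a metric on connected graphs *)

Section Distance.
Variable G : sgraph.
Implicit Types (x y z : G) (p : seq G).

(** [find] never exceeds [#|G|], so a shorter walk would lie in the search range and stop the search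
    earlier. *)
Lemma dist_le_walk x p : path (@adj G) x p -> dist x (last x p) <= size p.
Proof.
move=> xp; rewrite leqNgt; apply/negP => lt_p; have := lt_p.
have lt_pG : size p < #|G|.
  by apply: leq_trans lt_p _; rewrite (leq_trans (find_size _ _)) ?size_iota.
move/(before_find 0); rewrite nth_iota ?add0n // => /negbT/negP; apply.
by apply/existsP; exists (in_tuple p); rewrite /= xp eqxx.
Qed.

Hypothesis conG : connected G.

(** Connectedness rules out the default value [#|G|]: a walk without repeated vertices has length
    less than [#|G|], so the search succeeds. *)
Lemma geodesic_walk x y :
  exists p, [/\ path (@adj G) x p, last x p = y & size p = dist x y].
Proof.
have /connectP [p0 xp0 ->] := conG x y.
case: (shortenP xp0) => p xp p_uniq _.
have lt_pG : size p < #|G|.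
  by have := max_card (mem (x :: p)); rewrite (card_uniqP p_uniq).
have : has (walk_of_length x (last x p)) (iota 0 #|G|).
  apply/hasP; exists (size p); first by rewrite mem_iota.
  by apply/existsP; exists (in_tuple p); rewrite /= xp eqxx.
move=> hasp; have := nth_find 0 hasp; move: hasp; rewrite has_find size_iota => lt_d.
rewrite nth_iota // add0n => /existsP [q /andP [xq /eqP lastq]].
by exists q; split=> //; rewrite size_tuple.
Qed.

Lemma dist_refl x : dist x x = 0.
Proof. by apply/eqP; rewrite -leqn0 (@dist_le_walk x [::]). Qed.

Lemma dist_eq0 x y : dist x y = 0 -> x = y.
Proof. by have [p [_ <- <-]] := geodesic_walk x y => /size0nil ->. Qed.

Lemma dist_triangle y x z : dist x z <= dist x y + dist y z.
Proof.
have [p [xp lastp <-]] := geodesic_walk x y.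
have [q [yq <- <-]] := geodesic_walk y z.
by rewrite -lastp in yq *; rewrite -last_cat -size_cat dist_le_walk // cat_path xp.
Qed.

Lemma dist_sym x y : dist x y = dist y x.
Proof.
have le_dist (u w : G) : dist w u <= dist u w.
  have [p [up <- <-]] := geodesic_walk u w.
  have up' : path (@adj G) (last u p) (rev (belast u p)).
    by rewrite rev_path (eq_path (e' := @adj G)) // => a b; apply: adj_sym.
  have lastr : last (last u p) (rev (belast u p)) = u.
    by case: (p) => //= z q; rewrite rev_cons last_rcons.
  by have := dist_le_walk up'; rewrite lastr size_rev size_belast.
by apply/eqP; rewrite eqn_leq !le_dist.
Qed.

Lemma dist_eq1 x y : (dist x y == 1) = adj x y.
Proof.
apply/eqP/idP => [d1|xy].
  have [[|z [|? ?]] [/= ]] := geodesic_walk x y; rewrite d1 //.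
  by rewrite andbT => xz <-.
have := @dist_le_walk x [:: y]; rewrite /= xy => /(_ isT).
case E: (dist x y) => [|[|//]] // _.
by move: xy; rewrite (dist_eq0 E) adj_irr.
Qed.

Lemma dist_adj_le x y z : adj x y -> dist x z <= (dist y z).+1.
Proof. by rewrite -dist_eq1 => /eqP xy; rewrite -add1n -xy dist_triangle. Qed.

Lemma closer_neighbour x y :
  x != y -> exists2 z, adj x z & dist x y = (dist z y).+1.
Proof.
have [[|z p] [/= xp lastp sizep]] := geodesic_walk x y.
  by rewrite lastp eqxx.
case/andP: xp => xz zp _; exists z => //; apply/eqP.
by rewrite eqn_leq dist_adj_le // -sizep ltnS -lastp dist_le_walk.
Qed.

Lemma dist_le_diameter x y : dist x y <= diameter G.
Proof. by apply: leq_trans (leq_bigmax x); apply: (leq_bigmax y). Qed.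

Lemma diameter_attained : 0 < #|G| -> exists x y, dist x y = diameter G.
Proof.
move=> G0; have [x Ex] := eq_bigmax (fun x => \max_y dist x y) G0.
have [y Ey] := eq_bigmax (dist x) G0.
by exists x, y; rewrite -Ey -Ex.
Qed.

(** Summing over ordered pairs removes the enumeration ranks, after which any listing of the
    vertices may index the sum. *)
Lemma double_wiener : (wiener G).*2 = \sum_(x : G) \sum_(y : G) dist x y.
Proof.
rewrite -addnn /wiener {2}(exchange_big_dep predT) //= -big_split /=.
apply: eq_bigr => x _.
rewrite [RHS](bigID (fun y => enum_rank x < enum_rank y)) /=; congr (_ + _).
rewrite [RHS](bigD1 x) ?ltnn //= dist_refl add0n.
apply: eq_big => [y|y _]; last exact: dist_sym.
by rewrite -leqNgt ltn_neqAle andbC (inj_eq val_inj) (inj_eq enum_rank_inj).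
Qed.

End Distance.

(** A certificate for distances: a drop of at most one along each edge bounds all walks from below,
    and a neighbour realizing the drop yields a walk of exactly that length. *)
Lemma dist_unique (G : sgraph) (delta : G -> G -> nat) :
  (forall x y, (delta x y == 0) = (x == y)) ->
  (forall x y z, adj x y -> delta x z <= (delta y z).+1) ->
  (forall x z, x != z -> exists2 y, adj x y & delta x z = (delta y z).+1) ->
  connected G /\ forall x y, dist x y = delta x y.
Proof.
move=> delta0 delta_adj delta_step.
have walk k : forall x y, delta x y = k ->
    exists p, [/\ path (@adj G) x p, last x p = y & size p = k].
  elim: k => [|k IH] x y.
    by move/eqP; rewrite delta0 => /eqP ->; exists [::].
  move=> xyk; have [|z xz] := @delta_step x y; first by rewrite -delta0 xyk.
  rewrite xyk => -[/esym /IH [p [zp lastp sizep]]].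
  by exists (z :: p); rewrite /= xz lastp sizep.
have conG : connected G.
  move=> x y; have [p [xp <- _]] := walk _ x y erefl.
  by apply/connectP; exists p.
have ge_delta p : forall x, path (@adj G) x p -> delta x (last x p) <= size p.
  elim: p => [|y p IH] x /=; first by rewrite leqn0 delta0.
  case/andP=> xy /IH le_y; apply: (leq_trans (delta_adj _ _ _ xy)).
  by rewrite ltnS.
split=> // x y; apply/eqP; rewrite eqn_leq; apply/andP; split.
  by have [p [xp <- <-]] := walk _ x y erefl; apply: dist_le_walk.
by have [q [xq <- <-]] := geodesic_walk conG x y; apply: ge_delta.
Qed.

(** * Distances in trees, and projection to a geodesic *)

Section Trees.
Variable G : sgraph.
Hypothesis conG : connected G.
Hypothesis acyG : acyclic G.
Implicit Types (x y z : G).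

(** Geodesics from [x] and [x'] to [z] avoid [y]; glued together and shortened, they give a simple
    path from [x] to [x'] that [y] would close to a cycle. *)
Lemma closer_neighbour_unique z y x x' :
  adj y x -> adj y x' -> dist x z <= dist y z -> dist x' z <= dist y z -> x = x'.
Proof.
(* A geodesic from [w] to [z] through [y] would be longer than [dist y z]. *)
have avoid w : adj y w -> dist w z <= dist y z ->
    exists p, [/\ path (@adj G) w p, last w p = z & y \notin w :: p].
  move=> yw le_w; have [p [wp lastp sizep]] := geodesic_walk conG w z.
  exists p; split=> //; rewrite inE; apply/norP; split.
    by apply: contraTneq yw => ->; rewrite adj_irr.
  apply/negP => /splitPr yp; case: yp wp lastp sizep => p1 p2.
  rewrite cat_path last_cat size_cat /= => /and3P [_ _ yp2] lastp sizep.
  by have := dist_le_walk yp2; rewrite lastp; lia.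
move=> yx yx' /avoid - /(_ yx) [p [xp lastp yp]] /avoid - /(_ yx') [q [xq lastq yq]].
have xq' : path (@adj G) z (rev (belast x' q)).
  by rewrite -lastq rev_path (eq_path (e' := @adj G)) // => a b; apply: adj_sym.
have xr : path (@adj G) x (p ++ rev (belast x' q)) by rewrite cat_path xp lastp.
have lastr : last x (p ++ rev (belast x' q)) = x'.
  by rewrite last_cat lastp; case: (q) lastq => //= b s _; rewrite rev_cons last_rcons.
have yr : y \notin x :: p ++ rev (belast x' q).
  rewrite -cat_cons mem_cat negb_or yp mem_rev.
  by apply: contra yq; apply: mem_belast.
case: (shortenP xr) lastr => r {}xr r_uniq r_sub lastr.
apply/eqP/negPn/negP => neq_x.
case: (@acyG (y :: x :: r)).
  by case: (r) lastr neq_x => //= ->; rewrite eqxx.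
rewrite /ucycle [uniq _]/= -/(uniq (x :: r)) r_uniq andbT; apply/andP; split.
  by rewrite /= yx rcons_path xr lastr adj_sym.
apply: contra yr; rewrite !inE => /orP [->//|/r_sub ->]; exact: orbT.
Qed.

(** If the distances agreed, [x] and the next vertex on a geodesic from [y] to [z] would both be
    neighbours of [y] no farther from [z], hence equal, though the latter is strictly closer. *)
Lemma dist_adj_neq x y z : adj x y -> dist x z != dist y z.
Proof.
move=> xy; apply/eqP => eq_d; have [eq_yz|] := eqVneq y z.
  move: eq_d; rewrite eq_yz dist_refl => /(dist_eq0 conG) eq_xz.
  by move: xy; rewrite eq_xz eq_yz adj_irr.
move=> /(closer_neighbour conG) [w yw Ew].
have eq_xw : x = w.
  by apply: (@closer_neighbour_unique z y); rewrite ?eq_d ?Ew // adj_sym.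
by move: eq_d; rewrite eq_xw Ew; lia.
Qed.

(** Once a walk without backtracking has moved away from [u], the vertex it came from is the only
    neighbour of its current vertex that is no farther from [u], so it keeps moving away. *)
Lemma dist_along_ray u (w : nat -> G) m :
  (forall k, k < m -> adj (w k) (w k.+1)) ->
  (forall k, k.+1 < m -> w k != w k.+2) ->
  (0 < m -> dist (w 0) u <= dist (w 1) u) ->
  forall k, k <= m -> dist (w k) u = dist (w 0) u + k.
Proof.
move=> w_adj w_neq w01 k le_k.
have step i : i < m -> dist (w i.+1) u = (dist (w i) u).+1.
  elim: i => [|i IH] lt_i; have wi := w_adj _ lt_i.
    have := w01 lt_i; have := dist_adj_neq u wi.
    by rewrite adj_sym in wi; have := dist_adj_le conG u wi; lia.
  have {}IH := IH (ltnW lt_i).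
  apply/eqP; rewrite eqn_leq ltnNge dist_adj_le 1?adj_sym //=; apply/negP => le_i.
  have := w_neq _ lt_i; rewrite (@closer_neighbour_unique u (w i.+1) (w i) (w i.+2)) ?eqxx //.
    by rewrite adj_sym w_adj // ltnW.
  by rewrite IH.
elim: k le_k => [|k IH] le_k; first by rewrite addn0.
by rewrite step // IH 1?ltnW // addnS.
Qed.

Variables (d : nat) (v : nat -> G).
Hypothesis v_geo : forall i j, i <= d -> j <= d -> dist (v i) (v j) = gap i j.

(** The pair consists of the height of [u] and the index of its foot, a path vertex nearest to [u].
    From the foot, both directions along the path are rays whose first step does not approach
    [u]. *)
Lemma projection u :
  exists ha : nat * nat, ha.2 <= d /\
    forall j, j <= d -> dist u (v j) = ha.1 + gap ha.2 j.
Proof.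
pose a := [arg min_(i < (ord0 : 'I_d.+1)) dist u (v i)].
have min_a : forall j, j <= d -> dist u (v a) <= dist u (v j).
  rewrite /a; case: arg_minnP => // i _ imin j le_j.
  by have := imin (Ordinal (le_j : j < d.+1)) isT.
have le_a : a <= d by rewrite -ltnS.
have v_adj i j : i <= d -> j <= d -> gap i j = 1 -> adj (v i) (v j).
  by move=> le_i le_j ij; rewrite -(dist_eq1 conG) v_geo // ij.
have v_neq i j : i <= d -> j <= d -> gap i j = 2 -> v i != v j.
  move=> le_i le_j ij; apply/eqP => eq_v.
  by have := v_geo le_i le_j; rewrite eq_v dist_refl ij.
move: (nat_of_ord a) le_a min_a => {}a le_a min_a.
exists (dist u (v a), a); split=> //= j le_j.
rewrite !(dist_sym conG u).
have [le_aj|lt_ja] := leqP a j.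
  have := @dist_along_ray u (fun k => v (a + k)) (d - a) _ _ _ (j - a).
  rewrite /= addn0 subnKC // => ->; rewrite /gap; try lia.
  - by move=> k lt_k; apply: v_adj; rewrite /gap; lia.
  - by move=> k lt_k; apply: v_neq; rewrite /gap; lia.
  - by move=> lt_0; rewrite !(dist_sym conG _ u) min_a //; lia.
have := @dist_along_ray u (fun k => v (a - k)) a _ _ _ (a - j).
rewrite /= subn0 (subKn (ltnW lt_ja)) => ->; rewrite /gap; try lia.
- by move=> k lt_k; apply: v_adj; rewrite /gap; lia.
- by move=> k lt_k; apply: v_neq; rewrite /gap; lia.
- by move=> lt_0; rewrite !(dist_sym conG _ u) min_a //; lia.
Qed.

End Trees.

(** On a geodesic between two vertices realizing the diameter, the stretches bound distances from
    above, and the triangle inequality through the two ends forces equality. *)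
Lemma diametral_path (G : sgraph) : 0 < #|G| -> connected G ->
  exists v : nat -> G, forall i j, i <= diameter G -> j <= diameter G ->
    dist (v i) (v j) = gap i j.
Proof.
move=> G0 conG; have [x [y Exy]] := diameter_attained G0.
have [p [xp lastp sizep]] := geodesic_walk conG x y.
rewrite -Exy -sizep; exists (nth x (x :: p)).
have le_gap i j : i <= j -> j <= size p ->
    dist (nth x (x :: p) i) (nth x (x :: p) j) <= j - i.
  elim: j => [|j IH] le_ij le_j; first by move: le_ij; rewrite leqn0 => /eqP ->; rewrite dist_refl.
  have [->|neq_ij] := eqVneq i j.+1; first by rewrite dist_refl.
  apply: leq_trans (dist_triangle conG (nth x (x :: p) j) _ _) _.
  have : adj (nth x (x :: p) j) (nth x (x :: p) j.+1) by exact: (pathP x xp).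
  rewrite -(dist_eq1 conG) => /eqP ->.
  by have := IH; lia.
have geo i j : i <= j -> j <= size p ->
    dist (nth x (x :: p) i) (nth x (x :: p) j) = j - i.
  move=> le_ij le_j; apply/eqP; rewrite eqn_leq le_gap //=.
  have := le_gap _ _ (leq0n i) (leq_trans le_ij le_j).
  have := le_gap _ _ le_j (leqnn _).
  have := dist_triangle conG (nth x (x :: p) i) x y.
  have := dist_triangle conG (nth x (x :: p) j) (nth x (x :: p) i) y.
  by rewrite [nth _ _ (size p)]nth_last /= lastp -sizep; lia.
move=> i j le_i le_j; rewrite /gap; have [le_ij|lt_ji] := leqP i j.
  by rewrite geo //; lia.
by rewrite (dist_sym conG) (geo _ _ (ltnW lt_ji)) //; lia.
Qed.

(** * The Wiener index relative to a geodesic path *)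

Local Arguments iota : simpl never.

Definition path_sum d := \sum_(i <- iota 0 d.+1) \sum_(j <- iota 0 d.+1) gap i j.

Definition position_sum d a := \sum_(j <- iota 0 d.+1) gap a j.

(** Twice the sum equals [a * (a + 1) + (d - a) * (d - a + 1)], which falls short of [d * (d + 1)]
    by [2 * a * (d - a)]. *)
Lemma position_sumE d a :
  a <= d -> position_sum d a + a * (d - a) = position_sum d 0.
Proof.
have S_recr e b : position_sum e.+1 b = position_sum e b + gap b e.+1.
  by rewrite /position_sum -[e.+2]addn1 iotaD big_cat /= -[iota _ 1]/[:: e.+1] big_seq1.
(* The induction for [near] enters its range at [e = b], where this closed form supplies the
   value. *)
have far e b : e <= b -> (position_sum e b).*2 = e.+1 * (b.*2 - e).
  elim: e => [|e IH] le_e; first by rewrite /position_sum -[iota 0 1]/[:: 0] big_seq1 /gap; lia.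
  by rewrite S_recr doubleD IH 1?ltnW // /gap; nia.
have near e b : b <= e -> (position_sum e b).*2 = b * b.+1 + (e - b) * (e - b).+1.
  elim: e => [|e IH] le_b; first by have := far 0 b; lia.
  have [eq_b|lt_b] := eqVneq b e.+1; first by rewrite far //; nia.
  by rewrite S_recr doubleD IH /gap; nia.
move=> le_a; apply: double_inj; rewrite doubleD !near //; nia.
Qed.

(** The common interface of arbitrary and explicit trees: [us] lists the vertices off the path, [h]
    gives their heights and [a] their feet. *)
Definition framed (G : sgraph) d (v : nat -> G) (us : seq G) (h a : G -> nat) :=
  [/\ perm_eq (enum G) (map v (iota 0 d.+1) ++ us),
      forall i j, i <= d -> j <= d -> dist (v i) (v j) = gap i j
    & forall u, u \in us -> a u <= d /\
        forall j, j <= d -> dist u (v j) = h u + gap (a u) j].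

(** The ordered sum splits into path against path, path against the four vertices (twice), and the
    four among themselves; [position_sumE] evaluates the middle part, with its negative terms moved
    to the left. *)
Lemma framed_wiener (G : sgraph) d v (u1 u2 u3 u4 : G) h a :
  connected G -> framed d v [:: u1; u2; u3; u4] h a ->
  (wiener G).*2 + (a u1 * (d - a u1) + a u2 * (d - a u2)
                   + a u3 * (d - a u3) + a u4 * (d - a u4)).*2
  = path_sum d + (4 * position_sum d 0).*2
    + ((h u1 + h u2 + h u3 + h u4) * d.+1 +
       (dist u1 u2 + dist u1 u3 + dist u1 u4 +
        dist u2 u3 + dist u2 u4 + dist u3 u4)).*2.
Proof.
move=> conG [Gvu v_geo u_geo]; rewrite double_wiener //.
have sumG (F : G -> nat) : \sum_(x : G) F x =
    \sum_(i <- iota 0 d.+1) F (v i) + (F u1 + F u2 + F u3 + F u4).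
  rewrite -big_enum (perm_big _ Gvu) big_cat big_map /=.
  by rewrite !big_cons big_nil !addnA addn0.
have sum_u u : u \in [:: u1; u2; u3; u4] ->
    a u <= d /\ \sum_(i <- iota 0 d.+1) dist u (v i) = h u * d.+1 + position_sum d (a u).
  move=> /u_geo [le_a Eu]; split=> //; rewrite mulnC /position_sum.
  transitivity (\sum_(i <- iota 0 d.+1) (h u + gap (a u) i)).
    by apply: eq_big_seq => i; rewrite mem_iota => /andP [_ lt_i]; apply: Eu.
  by rewrite big_split /= big_const_seq count_predT size_iota iter_addn_0 mulnC.
have sum_vv : \sum_(i <- iota 0 d.+1) \sum_(j <- iota 0 d.+1) dist (v i) (v j) = path_sum d.
  apply: eq_big_seq => i; rewrite mem_iota => /andP [_ lt_i].
  by apply: eq_big_seq => j; rewrite mem_iota => /andP [_ lt_j]; apply: v_geo.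
rewrite sumG; under eq_bigr => i _ do rewrite sumG.
rewrite !sumG !big_split /= sum_vv.
have sum_uv u : \sum_(i <- iota 0 d.+1) dist (v i) u = \sum_(i <- iota 0 d.+1) dist u (v i).
  by apply: eq_bigr => i _; apply: dist_sym.
rewrite !sum_uv.
have [] := sum_u u1; rewrite ?inE ?eqxx ?orbT // => /position_sumE E1 ->.
have [] := sum_u u2; rewrite ?inE ?eqxx ?orbT // => /position_sumE E2 ->.
have [] := sum_u u3; rewrite ?inE ?eqxx ?orbT // => /position_sumE E3 ->.
have [] := sum_u u4; rewrite ?inE ?eqxx ?orbT // => /position_sumE E4 ->.
rewrite !dist_refl // (dist_sym conG u2 u1) !(dist_sym conG u3) !(dist_sym conG u4).
rewrite !mulnDl; lia.
Qed.

(** * The upper bound and its equality case *)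

Definition max_wiener2 d :=
  path_sum d + (4 * position_sum d 0).*2 + (4 * d + 12).*2.

(** The six gaps add up to [3 * (a4 - a1) + (a3 - a2)], at most [4 * (d - 2)], while each product is
    at least [d - 1]. The assumed equality makes all these estimates tight. *)
Lemma tight_leaves d a1 a2 a3 a4 D12 D13 D14 D23 D24 D34 :
  5 <= d -> 1 <= a1 -> a1 <= a2 -> a2 <= a3 -> a3 <= a4 -> a4 < d ->
  D12 <= 1 + 1 + gap a1 a2 -> D13 <= 1 + 1 + gap a1 a3 -> D14 <= 1 + 1 + gap a1 a4 ->
  D23 <= 1 + 1 + gap a2 a3 -> D24 <= 1 + 1 + gap a2 a4 -> D34 <= 1 + 1 + gap a3 a4 ->
  D12 + D13 + D14 + D23 + D24 + D34 + 4 * d =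
    4 * d + 8 + (a1 * (d - a1) + a2 * (d - a2) + a3 * (d - a3) + a4 * (d - a4)) ->
  [/\ [/\ a1 = 1, a2 = 1, a3 = d.-1 & a4 = d.-1], D12 = 2 /\ D34 = 2
    & [/\ D13 = d, D14 = d, D23 = d & D24 = d]].
Proof.
move=> d5 ge_a1 le_12 le_23 le_34 lt_a4.
have gapE i j : i <= j -> gap i j = j - i by rewrite /gap; lia.
have ge_a2 := leq_trans ge_a1 le_12; have ge_a3 := leq_trans ge_a2 le_23.
have ge_a4 := leq_trans ge_a3 le_34; have lt_a3 := leq_ltn_trans le_34 lt_a4.
have lt_a2 := leq_ltn_trans le_23 lt_a3; have lt_a1 := leq_ltn_trans le_12 lt_a2.
have le_13 := leq_trans le_12 le_23; have le_24 := leq_trans le_23 le_34.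
have le_14 := leq_trans le_13 le_34.
rewrite !gapE // => b12 b13 b14 b23 b24 b34.
(* The excess over [d - 1] vanishes only for [x] equal to 1 or [d - 1]. *)
have Q_ge x : 1 <= x -> x < d -> x * (d - x) = d - 1 + (x - 1) * (d - 1 - x).
  by clear; nia.
have out x : x < d -> (x - 1) * (d - 1 - x) = 0 -> x <= 1 \/ d.-1 <= x.
  by clear; move=> ? /eqP; rewrite muln_eq0; lia.
rewrite !Q_ge //.
have [{}out [out2 [out3 out4]]] := (conj (out _ lt_a1) (conj (out _ lt_a2) (conj (out _ lt_a3) (out _ lt_a4)))).
move: ((a1 - 1) * _) ((a2 - 1) * _) ((a3 - 1) * _) ((a4 - 1) * _) out out2 out3 out4
  => r1 r2 r3 r4 o1 o2 o3 o4 tight.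
have sumD : D12 + D13 + D14 + D23 + D24 + D34 <= 12 + 4 * (d - 2).
  clear -ge_a1 le_12 le_23 le_34 lt_a4 b12 b13 b14 b23 b24 b34; lia.
have [z1 z2 z3 z4] : [/\ r1 = 0, r2 = 0, r3 = 0 & r4 = 0].
  clear -tight sumD d5; split; lia.
have [{}o1 {}o2 {}o3 {}o4] := And4 (o1 z1) (o2 z2) (o3 z3) (o4 z4).
subst r1 r2 r3 r4.
(* Every foot is now 1 or [d - 1], and the gaps reach [4 * (d - 2)] only with two feet at each
   end. *)
have [e2 e3] : a2 <= 1 /\ d.-1 <= a3.
  clear -tight o1 o2 o3 o4 d5 b12 b13 b14 b23 b24 b34 ge_a1 le_12 le_23 le_34 lt_a4.
  by case: o2 o3 => ? [?|?]; lia.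
have [e1' e2' e3' e4'] : [/\ a1 = 1, a2 = 1, a3 = d.-1 & a4 = d.-1].
  by clear -e2 e3 d5 ge_a1 le_12 le_23 le_34 lt_a4; split; lia.
clear -tight e1' e2' e3' e4' d5 b12 b13 b14 b23 b24 b34; subst a1 a2 a3 a4.
by do !split=> //; lia.
Qed.

Lemma tree_frame (G : sgraph) d : tree_family (d + 5) d G -> 5 <= d ->
  exists (v : nat -> G) (u1 u2 u3 u4 : G) (h a : G -> nat),
   [/\ framed d v [:: u1; u2; u3; u4] h a,
     (wiener G).*2 <= max_wiener2 d
   & 7 <= d -> (wiener G).*2 = max_wiener2 d ->
      [/\ [/\ h u1 = 1, h u2 = 1, h u3 = 1 & h u4 = 1],
        [/\ a u1 = 1, a u2 = 1, a u3 = d.-1 & a u4 = d.-1],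
        dist u1 u2 = 2 /\ dist u3 u4 = 2
      & [/\ dist u1 u3 = d, dist u1 u4 = d, dist u2 u3 = d & dist u2 u4 = d]]].
Proof.
move=> [[G0 conG acyG] cardG diamG] d5.
have [v] := diametral_path G0 conG; rewrite diamG => v_geo; exists v.
have [ha haP] := fin_all_exists (projection conG acyG v_geo).
pose h u := (ha u).1; pose a u := (ha u).2.
have a_le u : a u <= d by have [] := haP u.
have u_geo u j : j <= d -> dist u (v j) = h u + gap (a u) j.
  by have [_] := haP u; apply.
have u_root u : dist u (v (a u)) = h u by rewrite u_geo // /gap; lia.
have D_le x y : dist x y <= h x + h y + gap (a x) (a y).
  rewrite -(u_root x) -(u_root y) -v_geo //.
  have := dist_triangle conG (v (a x)) x y.
  by have := dist_triangle conG (v (a y)) (v (a x)) y; rewrite (dist_sym conG (v (a y)) y); lia.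
(* The ends of the diametral path are at distances [h + a] and [h + (d - a)], neither above the
   diameter. *)
have h_le x : h x <= a x /\ a x + h x <= d.
  have := dist_le_diameter x (v 0); have := dist_le_diameter x (v d).
  by have := a_le x; rewrite diamG !u_geo // /gap; lia.
pose P := map v (iota 0 d.+1).
have P_uniq : uniq P.
  rewrite map_inj_in_uniq ?iota_uniq // => i j; rewrite !mem_iota => /andP [_ lt_i] /andP [_ lt_j] eq_v.
  by have := v_geo _ _ lt_i lt_j; rewrite eq_v dist_refl // /gap; lia.
have h_gt0 x : x \notin P -> 0 < h x.
  apply: contraNltn; rewrite leqn0 => /eqP hx0.
  by apply/mapP; exists (a x); rewrite ?mem_iota ?ltnS ?a_le //; apply: (dist_eq0 conG); rewrite u_root.
have notinP x : 0 < h x -> x \notin P.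
  move=> hx; apply/negP => /mapP [i]; rewrite mem_iota => /andP [_ lt_i] Ex.
  by have := u_geo x i lt_i; rewrite Ex dist_refl // -Ex; lia.
have parent x : 1 < h x -> exists2 y, y \notin P & parent_of (@dist G) h a y x.
  move=> hx; have [|y xy Exy] := @closer_neighbour _ conG x (v (a x)).
    by apply/eqP => /(congr1 (dist x)); rewrite u_root dist_refl //; lia.
  have Ey := u_geo y (a x) (a_le x); rewrite u_root in Exy.
  (* With [g] the gap between the two feet, [h y + g = h x - 1] and [h x + g <= h y + 1] leave only
     [g = 0]. *)
  have := dist_adj_le conG (v (a y)) xy; rewrite u_root u_geo // /gap => le_y.
  rewrite /gap in Ey.
  exists y; first by apply: notinP; lia.
  by split; [lia|lia|apply/eqP; rewrite dist_eq1 // adj_sym].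
(* As [a x <= d], this orders by height first and by foot second: parents precede children, and
   leaves come in the order of feet that [tight_leaves] asks for. *)
pose key x := h x * d.+1 + a x.
pose us := sort (fun x y => key x <= key y) [seq x <- enum G | x \notin P].
have us_sorted : sorted (fun x y => key x <= key y) us.
  by apply: sort_sorted => x y; apply: leq_total.
have mem_us x : (x \in us) = (x \notin P) by rewrite mem_sort mem_filter mem_enum andbT.
have us_perm : perm_eq (enum G) (P ++ us).
  apply: uniq_perm; first exact: enum_uniq.
    rewrite cat_uniq P_uniq sort_uniq filter_uniq ?enum_uniq // andbT.
    by apply/hasPn => x; rewrite mem_us.
  by move=> x; rewrite mem_enum mem_cat mem_us orbN.
have us_size : size us = 4.
  have := perm_size us_perm; rewrite /P -cardE size_cat size_map size_iota cardG; move: (size us) => k; lia.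
move: us us_sorted mem_us us_perm us_size => [|u1 [|u2 [|u3 [|u4 [|//]]]]] //.
move=> us_sorted mem_us us_perm _; exists u1, u2, u3, u4, h, a.
have fr : framed d v [:: u1; u2; u3; u4] h a.
  by split=> // u _; split=> // j; apply: u_geo.
have off u : u \in [:: u1; u2; u3; u4] -> 0 < h u by rewrite mem_us; apply: h_gt0.
have := (off u1, off u2, off u3, off u4); rewrite !inE !eqxx !orbT.
case=> [[[/(_ isT) h1 /(_ isT) h2] /(_ isT) h3] /(_ isT) h4].
have in_us y : y \notin P -> [\/ y = u1, y = u2, y = u3 | y = u4].
  rewrite -mem_us !inE => /or4P [] /eqP ->; 
  by [constructor 1|constructor 2|constructor 3|constructor 4].
have key_lt x y : h x < h y -> key x < key y.
  by rewrite /key; have := a_le x; nia.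
have key_h x y : key x <= key y -> h x <= h y.
  by move=> le_k; rewrite leqNgt; apply: contraL le_k => /key_lt; rewrite -ltnNge.
have key_a x y : key x <= key y -> h x = h y -> a x <= a y.
  by rewrite /key => + hxy; rewrite hxy leq_add2l.
have /and4P [k12 k23 k34 _] := us_sorted.
have [h12 h23 h34] := And3 (key_h _ _ k12) (key_h _ _ k23) (key_h _ _ k34).
have child x : 0 < h x -> h x = 1 \/ 
    [\/ parent_of (@dist G) h a u1 x, parent_of (@dist G) h a u2 x,
        parent_of (@dist G) h a u3 x | parent_of (@dist G) h a u4 x].
  move=> hx; have [hx1|] := leqP (h x) 1; first by left; lia.
  move=> /parent [y yP pyx]; right.
  by case: (in_us y yP) pyx => ->; [constructor 1|constructor 2|constructor 3|constructor 4].
(* Sorted heights exclude a parent standing at or after its child in the list. *)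
have P1 : h u1 = 1 by case: (child _ h1) => [//|[] []]; lia.
have P2 : h u2 = 1 \/ parent_of (@dist G) h a u1 u2.
  by case: (child _ h2) => [|[]]; [left|right|case; lia|case; lia|case; lia].
have P3 : [\/ h u3 = 1, parent_of (@dist G) h a u1 u3 | parent_of (@dist G) h a u2 u3].
  by case: (child _ h3) => [|[]]; [constructor 1|constructor 2|constructor 3|case; lia|case; lia].
have P4 : [\/ h u4 = 1, parent_of (@dist G) h a u1 u4,
    parent_of (@dist G) h a u2 u4 | parent_of (@dist G) h a u3 u4].
  by case: (child _ h4) => [|[]]; [constructor 1|constructor 2|constructor 3|constructor 4|case; lia].
have [] := four_vertices_bound D_le (dist_sym conG) (dist_triangle conG) h_le d5 P1 h12 h23 h34 P2 P3 P4.
have := framed_wiener conG fr; rewrite /max_wiener2 => W le_W eq_W.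
split=> //; first by lia.
move=> d7 eq_max; have [||{}h2 {}h3 {}h4] := eq_W => //; first by lia.
rewrite P1 h2 h3 h4 eq_max in W.
have D_le1 x y : h x = 1 -> h y = 1 -> dist x y <= 1 + 1 + gap (a x) (a y).
  by move=> hx hy; have := D_le x y; rewrite hx hy.
have a_lt x : h x = 1 -> 1 <= a x /\ a x < d.
  by move=> hx; have := h_le x; rewrite hx addn1.
have le_a x y : key x <= key y -> h x = 1 -> h y = 1 -> a x <= a y.
  by move=> xy hx hy; apply: key_a xy _; rewrite hx.
have tight := tight_leaves d5 (a_lt _ P1).1
  (le_a _ _ k12 P1 h2) (le_a _ _ k23 h2 h3) (le_a _ _ k34 h3 h4) (a_lt _ h4).2
  (D_le1 _ _ P1 h2) (D_le1 _ _ P1 h3) (D_le1 _ _ P1 h4)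
  (D_le1 _ _ h2 h3) (D_le1 _ _ h2 h4) (D_le1 _ _ h3 h4).
case: tight => [|? ? ?]; last by [].
by clear -W; lia.
Qed.

(** * Certificates for explicit trees *)

Lemma acyclic_of_unique_lower_neighbour (G : sgraph) (r : G -> nat) :
  injective r ->
  (forall x y z, adj x y -> adj x z -> r y < r x -> r z < r x -> y = z) ->
  acyclic G.
Proof.
move=> r_inj r_low [//|x0 c0] size_c /andP [].
set c := x0 :: c0 in size_c *; have cx0 : x0 \in c := mem_head _ _.
(* The vertex of highest rank on a cycle has two distinct neighbours there, both of lower rank. *)
pose m := [arg max_(x > x0 | x \in c) r x].
have [mc m_max] : m \in c /\ forall x, x \in c -> r x <= r m.
  by rewrite /m; case: arg_maxnP.
have [i c' Ec] := rot_to mc.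
rewrite -(rot_cycle i) -(rot_uniq i) Ec; rewrite -(size_rot i) Ec in size_c.
have {}m_max x : x \in c' -> x != m -> r x < r m.
  move=> xc' neq_x; rewrite ltn_neqAle (inj_eq r_inj) neq_x m_max //.
  by rewrite -(mem_rot i) Ec inE xc' orbT.
case: c' size_c {Ec} m_max => [//|y c']; case/lastP: c' => [//|s z] _ m_max.
rewrite /= rcons_path last_rcons !inE !mem_rcons !inE => /and3P [my _ zm].
rewrite !negb_or => /and3P [/and3P [neq_y neq_z _] /andP [neq_yz _] _].
case/eqP: neq_yz; apply: (r_low m) => //; first by rewrite adj_sym.
  by apply: m_max; rewrite ?inE ?eqxx // eq_sym.
by apply: m_max; rewrite ?inE ?mem_rcons ?inE ?eqxx ?orbT // eq_sym.
Qed.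

Definition edge_in (E : seq (nat * nat)) i j := ((i, j) \in E) || ((j, i) \in E).

(** [em_lt] and [em_uniq] exclude cycles, [em_eq0], [em_edge] and [em_step] feed [dist_unique],
    [em_le] bounds the diameter, and [em_path] and [em_leg] give the frame. Indices in [nat] leave
    every field to arithmetic or computation. *)
Record explicit_metric d (E : seq (nat * nat)) (delta : nat -> nat -> nat)
    (H A : nat -> nat) : Prop := ExplicitMetric {
  em_lt : forall i j, (i, j) \in E -> i < j < d + 5;
  em_uniq : forall i j k, (i, k) \in E -> (j, k) \in E -> i = j;
  em_eq0 : forall i j, i < d + 5 -> j < d + 5 -> (delta i j == 0) = (i == j);
  em_edge : forall i j k, (i, j) \in E -> k < d + 5 -> gap (delta i k) (delta j k) <= 1;
  em_step : forall i k, i < d + 5 -> k < d + 5 -> i != k ->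
    exists j, edge_in E i j && (delta i k == (delta j k).+1);
  em_le : forall i j, i < d + 5 -> j < d + 5 -> delta i j <= d;
  em_path : forall i j, i <= d -> j <= d -> delta i j = gap i j;
  em_leg : forall k, d < k < d + 5 -> A k <= d /\
    forall j, j <= d -> delta k j = H k + gap (A k) j
}.

Section ExplicitTree.
Variables (d : nat) (E : seq (nat * nat)) (delta : nat -> nat -> nat) (H A : nat -> nat).
Hypothesis em : explicit_metric d E delta H A.
Let G := graph_of_edges (d + 5) E.

Lemma explicit_dist : connected G /\ forall x y : 'I_(d + 5), @dist G x y = delta x y.
Proof.
apply: (@dist_unique G (fun x y : 'I_(d + 5) => delta x y)).
- by move=> x y; rewrite (em_eq0 em).
- move=> x y z /andP [_ /orP [] xy]; have := em_edge em xy (ltn_ord z); rewrite /gap; lia.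
move=> x z neq_xz; have [j /andP [xj /eqP Ej]] := em_step em (ltn_ord x) (ltn_ord z) neq_xz.
have lt_j : j < d + 5.
  by case/orP: xj => /(em_lt em) => /andP [] //; move=> lt1 /(ltn_trans lt1).
exists (Ordinal lt_j) => /=; last by [].
apply/andP; split; last exact: xj.
apply/eqP => /(congr1 val) /= eq_xj; case/orP: xj => /(em_lt em); rewrite eq_xj ltnn //.
Qed.

Let conG := proj1 explicit_dist.
Let distG := proj2 explicit_dist.

Lemma explicit_tree_family : tree_family (d + 5) d G.
Proof.
have lt0 : 0 < d + 5 by lia.
have ltd : d < d + 5 by lia.
split; last 1 first.
- apply/eqP; rewrite eqn_leq; apply/andP; split.
    by apply/bigmax_leqP => x _; apply/bigmax_leqP => y _; rewrite distG (em_le em).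
  apply: leq_trans (@dist_le_diameter G (Ordinal lt0) (Ordinal ltd)).
  by rewrite distG /= (em_path em) // /gap; lia.
- split=> //; first by rewrite card_ord.
  apply: (@acyclic_of_unique_lower_neighbour G (@nat_of_ord (d + 5))) => [|x y z].
    exact: val_inj.
  have lower (w : 'I_(d + 5)) : @adj G x w -> w < x -> (w : nat, x : nat) \in E.
    by move=> /andP [_ /orP [/(em_lt em)/andP [lt_xw _]|//]]; rewrite ltnNge ltnW.
  move=> xy xz lt_y lt_z; apply: val_inj.
  exact: (em_uniq em (lower y xy lt_y) (lower z xz lt_z)).
- by rewrite card_ord.
Qed.

Lemma explicit_wiener :
  (wiener G).*2 + (A d.+1 * (d - A d.+1) + A d.+2 * (d - A d.+2)
                   + A d.+3 * (d - A d.+3) + A d.+4 * (d - A d.+4)).*2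
  = path_sum d + (4 * position_sum d 0).*2
    + ((H d.+1 + H d.+2 + H d.+3 + H d.+4) * d.+1 +
       (delta d.+1 d.+2 + delta d.+1 d.+3 + delta d.+1 d.+4 +
        delta d.+2 d.+3 + delta d.+2 d.+4 + delta d.+3 d.+4)).*2.
Proof.
have lt0 : 0 < d + 5 by lia.
(* The default vertex 0 is taken only from index [d + 5] on. *)
pose v i : G := insubd (Ordinal lt0) i.
have vE i : i < d + 5 -> nat_of_ord (v i) = i by move=> lt_i; rewrite val_insubd lt_i.
have fr : framed d v [:: v d.+1; v d.+2; v d.+3; v d.+4]
    (fun x : 'I_(d + 5) => H x) (fun x : 'I_(d + 5) => A x).
  split.
  - have -> : map v (iota 0 d.+1) ++ [:: v d.+1; v d.+2; v d.+3; v d.+4] =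
        map v (iota 0 (d + 5)).
      by rewrite -addSnnS iotaD map_cat.
    have -> // : enum G = map v (iota 0 (d + 5)).
    apply: (inj_map (@ord_inj (d + 5))); rewrite val_enum_ord -map_comp.
    by rewrite -[LHS]map_id; apply/eq_in_map => i; rewrite mem_iota => /andP [_ /vE].
  - by move=> i j le_i le_j; rewrite distG !vE ?(em_path em) //; lia.
  move=> u us.
  have [k [k_d Eu]] : exists k, d < k < d + 5 /\ u = v k.
    move: us; rewrite !inE => /or4P [] /eqP ->;
      [exists d.+1|exists d.+2|exists d.+3|exists d.+4]; split=> //; lia.
  have lt_k : k < d + 5 by lia.
  have [le_A EA] := em_leg em k_d; rewrite Eu vE //; split=> // j le_j.
  by rewrite distG !vE ?EA //; lia.
have := framed_wiener conG fr; rewrite !distG !vE //; lia.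
Qed.

End ExplicitTree.

(** * The distances in [treeA] *)

Definition leaf_height d i : nat := d < i.
Definition leaf_root d i := if i <= d then i else if i <= d.+2 then 1 else d.-1.

(** The added vertices are leaves, so two distinct ones with the same foot are still joined through
    it. *)
Definition leaf_dist (H A : nat -> nat) i j :=
  if i == j then 0 else H i + H j + gap (A i) (A j).

Lemma leaf_height_path d i : i <= d -> leaf_height d i = 0.
Proof. by rewrite /leaf_height ltnNge => ->. Qed.

Lemma leaf_root_path d i : i <= d -> leaf_root d i = i.
Proof. by rewrite /leaf_root => ->. Qed.

Lemma leaf_height_leaf d k : leaf_height d (d.+1 + k) = 1.
Proof. by rewrite /leaf_height addSn ltnS leq_addr. Qed.

Lemma leaf_root_leaf d k : leaf_root d (d.+1 + k) = if k < 2 then 1 else d.-1.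
Proof.
rewrite /leaf_root addSn ltnNge leq_addr /= ltnS -addn1 leq_add2l.
by case: k => [|[|k]].
Qed.

Lemma leafP d i : i < d + 5 ->
  [\/ [/\ i <= d, leaf_height d i = 0 & leaf_root d i = i],
      [/\ d < i, i <= d.+2, leaf_height d i = 1 & leaf_root d i = 1]
    | [/\ d.+2 < i, i < d + 5, leaf_height d i = 1 & leaf_root d i = d.-1]].
Proof.
rewrite /leaf_height /leaf_root => lt_i; have [le_i|lt_di] := leqP i d.
  by constructor 1.
by have [le_i|lt_di2] := leqP i d.+2; [constructor 2|constructor 3].
Qed.

(** Written with [d + 5] throughout, so that the resulting graph is convertible to
    [treeA (d + 5)]. *)
Definition treeA_edges d := path_edges (d + 5) ++
  [:: (1, d + 5 - 4); (1, d + 5 - 3); (d + 5 - 6, d + 5 - 2); (d + 5 - 6, d + 5 - 1)].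

Lemma mem_path_edges n i j : ((i, j) \in path_edges n) = (i < n - 5) && (j == i.+1).
Proof.
apply/mapP/andP => [[k k_in [-> ->]]|[lt_i /eqP ->]]; first by rewrite mem_iota in k_in.
by exists i; rewrite ?mem_iota.
Qed.

Lemma mem_treeA_edges d i j : 5 <= d -> ((i, j) \in treeA_edges d) =
  [|| (i < d) && (j == i.+1), (i == 1) && (d < j <= d.+2)
    | (i == d.-1) && (d.+2 < j < d + 5)].
Proof.
by move=> d5; rewrite mem_cat mem_path_edges !inE !xpair_eqE; lia.
Qed.

Lemma treeA_metric d : 5 <= d ->
  explicit_metric d (treeA_edges d) (leaf_dist (leaf_height d) (leaf_root d))
    (leaf_height d) (leaf_root d).
Proof.
move=> d5; split.
- by move=> i j; rewrite mem_treeA_edges //; lia.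
- by move=> i j k; rewrite !mem_treeA_edges //; lia.
- move=> i j /leafP Pi /leafP Pj; rewrite /leaf_dist; case: (i =P j) => // neq_ij.
  apply/negbTE; rewrite /gap; case: Pi => [[? -> ->]|[? ? -> ->]|[? ? -> ->]] //.
  by case: Pj => [[? -> ->]|[? ? -> ->]|[? ? -> ->]] //; lia.
- move=> i j k ij lt_k.
  have lt_ij : i <= d /\ i < j < d + 5 by move: ij; rewrite mem_treeA_edges //; lia.
  have {lt_ij}[le_i /andP [lt_ij lt_j]] := lt_ij.
  have Pk := leafP lt_k; have Pj := leafP lt_j.
  move: ij; rewrite mem_treeA_edges // /leaf_dist.
  rewrite (leaf_height_path le_i) (leaf_root_path le_i).
  rewrite /gap; case: Pk => [[? -> ->]|[? ? -> ->]|[? ? -> ->]];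
  by case: Pj => [[? -> ->]|[? ? -> ->]|[? ? -> ->]]; case: (i =P k) (j =P k) => [?|?] [?|?]; lia.
- move=> i k lt_i lt_k neq_ik; rewrite /edge_in.
  have Pk := leafP lt_k.
  (* The neighbour of [i] towards [k]: for [i] on the path, one step towards the foot of [k], or [k]
     itself if [i] is that foot; for a leaf, its own foot. *)
  case: (leafP lt_i) => [[le_i Hi Ai]|[? ? Hi Ai]|[? ? Hi Ai]].
  + have [lt_ki|le_ik] := ltnP (leaf_root d k) i.
      exists i.-1; rewrite !mem_treeA_edges // /leaf_dist (negbTE neq_ik).
      rewrite (@leaf_height_path _ i.-1) ?(@leaf_root_path _ i.-1); try lia.
      rewrite Hi Ai /gap; apply/andP; split; first by clear -lt_ki le_i; lia.
      case: Pk lt_ki => [[? -> ->]|[? ? -> ->]|[? ? -> ->]] lt_ki; case: (i.-1 =P k); lia.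
    have [eq_ik|lt_ik] := eqVneq i (leaf_root d k).
      exists k; rewrite !mem_treeA_edges // /leaf_dist (negbTE neq_ik) eqxx.
      by rewrite Hi Ai /gap; case: Pk eq_ik {le_ik} => [[? -> ->]|[? ? -> ->]|[? ? -> ->]]; lia.
    exists i.+1; rewrite !mem_treeA_edges // /leaf_dist (negbTE neq_ik).
    have lt_id : i < d by case: Pk le_ik lt_ik => [[? _ ->]|[? ? _ ->]|[? ? _ ->]]; lia.
    rewrite (leaf_height_path lt_id) (leaf_root_path lt_id).
    by rewrite Hi Ai /gap; case: Pk le_ik lt_ik => [[? -> ->]|[? ? -> ->]|[? ? -> ->]]; case: (i.+1 =P k); lia.
  + exists 1; rewrite !mem_treeA_edges // /leaf_dist (negbTE neq_ik).
    rewrite (@leaf_height_path _ 1) ?(@leaf_root_path _ 1); try lia.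
    by rewrite Hi Ai /gap; case: Pk => [[? -> ->]|[? ? -> ->]|[? ? -> ->]]; case: (1 =P k); lia.
  exists d.-1; rewrite !mem_treeA_edges // /leaf_dist (negbTE neq_ik).
  rewrite (@leaf_height_path _ d.-1) ?(@leaf_root_path _ d.-1) ?leq_pred //.
  by rewrite Hi Ai /gap; case: Pk => [[? -> ->]|[? ? -> ->]|[? ? -> ->]]; case: (d.-1 =P k); lia.
- move=> i j /leafP Pi /leafP Pj; rewrite /leaf_dist; case: eqP => // _; rewrite /gap.
  case: Pi => [[? -> ->]|[? ? -> ->]|[? ? -> ->]];
  by case: Pj => [[? -> ->]|[? ? -> ->]|[? ? -> ->]]; lia.
- move=> i j le_i le_j; rewrite /leaf_dist /leaf_height /leaf_root le_i le_j.
  by rewrite !ltnNge le_i le_j /= /gap; case: eqP => //; lia.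
move=> k /andP [lt_dk lt_k]; split.
  by case: (leafP lt_k) => [[? _ ->]|[? ? _ ->]|[? ? _ ->]]; lia.
move=> j le_j; rewrite /leaf_dist (leaf_height_path le_j) (leaf_root_path le_j) addn0.
by case: eqP => //; lia.
Qed.

(* In [treeB] and [treeC] the vertices hanging above the same path vertex form
   a chain. *)
Definition chain_dist (H A : nat -> nat) i j :=
  if A i == A j then gap (H i) (H j) else H i + H j + gap (A i) (A j).

(** A boolean form of [explicit_metric], by which the two sporadic trees are verified by
    computation. *)
Definition check_metric d (E : seq (nat * nat)) delta (H A : nat -> nat) :=
  let V := iota 0 (d + 5) in let P := iota 0 d.+1 in
  [&& all (fun e => e.1 < e.2 < d + 5) E,
      all (fun e => all (fun f => (e.2 == f.2) ==> (e.1 == f.1)) E) E,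
      all (fun i => all (fun j => (delta i j == 0) == (i == j)) V) V,
      all (fun e => all (fun k => gap (delta e.1 k) (delta e.2 k) <= 1) V) E,
      all (fun i => all (fun k => (i != k) ==>
        has (fun j => edge_in E i j && (delta i k == (delta j k).+1)) V) V) V,
      all (fun i => all (fun j => delta i j <= d) V) V,
      all (fun i => all (fun j => delta i j == gap i j) P) P
    & all (fun k => (A k <= d) &&
        all (fun j => delta k j == H k + gap (A k) j) P) (iota d.+1 4)].

Lemma check_metricP d E delta H A :
  check_metric d E delta H A -> explicit_metric d E delta H A.
Proof.
have inV i : i < d + 5 -> i \in iota 0 (d + 5) by rewrite mem_iota.
have inP i : i <= d -> i \in iota 0 d.+1 by rewrite mem_iota.
case/and4P=> /allP c1 /allP c2 /allP c3 /and5P [/allP c4 /allP c5 /allP c6 /allP c7 /allP c8].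
split.
- by move=> i j /c1.
- by move=> i j k /c2 /allP c /c /=; rewrite eqxx => /eqP.
- by move=> i j /inV /c3 /allP c /inV /c /eqP.
- by move=> i j k /c4 /allP c /inV /c.
- move=> i k /inV /c5 /allP c /inV /c /implyP {}c /c /hasP [j _ ij]; by exists j.
- by move=> i j /inV /c6 /allP c /inV /c.
- by move=> i j /inP /c7 /allP c /inP /c /eqP.
move=> k k_d; have /c8 : k \in iota d.+1 4 by rewrite mem_iota; lia.
by case/andP=> ? /allP c; split=> // j /inP /c /eqP.
Qed.

Lemma treeB10_metric : exists H A,
  explicit_metric 5 (path_edges 10 ++ [:: (1, 6); (4, 7); (2, 8); (8, 9)])
    (chain_dist H A) H A /\ 
  (H 6, H 7, H 8, H 9) = (1, 1, 1, 2) /\ (A 6, A 7, A 8, A 9) = (1, 4, 2, 2).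
Proof.
(* Tables of heights and feet by vertex: 6 and 7 are leaves at 1 and 4, and the chain 8, 9 stands
   above 2. *)
exists (nth 0 [:: 0; 0; 0; 0; 0; 0; 1; 1; 1; 2]).
exists (nth 0 [:: 0; 1; 2; 3; 4; 5; 1; 4; 2; 2]).
by split=> //; apply: check_metricP; vm_compute.
Qed.

Lemma treeC11_metric : exists H A,
  explicit_metric 6 (path_edges 11 ++ [:: (5, 7); (3, 8); (8, 9); (9, 10)])
    (chain_dist H A) H A /\
  (H 7, H 8, H 9, H 10) = (1, 1, 2, 3) /\ (A 7, A 8, A 9, A 10) = (5, 3, 3, 3).
Proof.
(* Here 7 is a leaf at 5, and the chain 8, 9, 10 stands above 3. *)
exists (nth 0 [:: 0; 0; 0; 0; 0; 0; 0; 1; 1; 2; 3]).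
exists (nth 0 [:: 0; 1; 2; 3; 4; 5; 6; 5; 3; 3; 3]).
by split=> //; apply: check_metricP; vm_compute.
Qed.

(** * Attaining the bound, and uniqueness *)

Lemma treeA_wiener d : 5 <= d -> (wiener (treeA (d + 5))).*2 = max_wiener2 d.
Proof.
move=> d5; have := explicit_wiener (treeA_metric d5).
(* The bound is met because [4 * (d + 1) + (4 + 4 * d)] equals [4 * d + 12 + 4 * (d - 1)]. *)
rewrite -[graph_of_edges _ _]/(treeA (d + 5)) /max_wiener2 /leaf_dist.
have H1 := leaf_height_leaf d; have A1 := leaf_root_leaf d.
have := (H1 0, H1 1, H1 2, H1 3); rewrite addn0 addn1 addn2 addn3 => -[[[-> ->] ->] ->].
have := (A1 0, A1 1, A1 2, A1 3); rewrite addn0 addn1 addn2 addn3 => -[[[-> ->] ->] ->] /=.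
have -> : d - d.-1 = 1 by lia.
rewrite !eqSS /gap.
have neq k : (d == d + k.+1) = false by lia.
by have := (neq 0, neq 1, neq 2); rewrite addn1 addn2 addn3 => -[[-> ->] ->]; lia.
Qed.

Lemma tree_wiener_le d (T : sgraph) : 5 <= d ->
  tree_family (d + 5) d T -> (wiener T).*2 <= max_wiener2 d.
Proof. by move=> d5 Td; have [v [u1 [u2 [u3 [u4 [h [a []]]]]]]] := tree_frame Td d5. Qed.

Lemma maximizes_wienerP d (G : sgraph) : 5 <= d ->
  tree_family (d + 5) d G -> (wiener G).*2 = max_wiener2 d ->
  maximizes_wiener (d + 5) d G.
Proof.
move=> d5 Gd WG; split=> // T Td.
by rewrite -leq_double WG tree_wiener_le.
Qed.

Lemma treeA_maximizes d : 5 <= d -> maximizes_wiener (d + 5) d (treeA (d + 5)).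
Proof.
move=> d5; apply: maximizes_wienerP => //; last exact: treeA_wiener.
exact: explicit_tree_family (treeA_metric d5).
Qed.

(** Both sides of the numerical bound are 52: heights give 30 and mutual distances 22, against 32
    plus products summing to 20. *)
Lemma treeB10_maximizes : maximizes_wiener 10 5 (treeB 10).
Proof.
have [H [A [em [[h1 h2 h3 h4] [a1 a2 a3 a4]]]]] := treeB10_metric.
apply: (@maximizes_wienerP 5) => //; first exact: explicit_tree_family em.
have := explicit_wiener em; rewrite /max_wiener2 /chain_dist.
by rewrite h1 h2 h3 h4 a1 a2 a3 a4 /gap /= -[graph_of_edges _ _]/(treeB 10); lia.
Qed.

(** Both sides of the numerical bound are 68: heights give 49 and mutual distances 19, against 36
    plus products summing to 32. *)
Lemma treeC11_maximizes : maximizes_wiener 11 6 (treeC 11).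
Proof.
have [H [A [em [[h1 h2 h3 h4] [a1 a2 a3 a4]]]]] := treeC11_metric.
apply: (@maximizes_wienerP 6) => //; first exact: explicit_tree_family em.
have := explicit_wiener em; rewrite /max_wiener2 /chain_dist.
by rewrite h1 h2 h3 h4 a1 a2 a3 a4 /gap /= -[graph_of_edges _ _]/(treeC 11); lia.
Qed.

(** An isometry is injective, hence bijective by counting, and adjacency is distance one; the
    isomorphism is the inverse of [g]. *)
Lemma isomorphic_of_isometry (G H : sgraph) (g : H -> G) :
  connected G -> connected H -> #|G| = #|H| ->
  (forall x y, dist (g x) (g y) = dist x y) -> isomorphic G H.
Proof.
move=> conG conH GH g_iso.
have g_inj : injective g.
  by move=> x y eq_g; apply: (dist_eq0 conH); rewrite -g_iso eq_g dist_refl.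
have [|f gK fK] := inj_card_bij g_inj; first by rewrite GH.
exists f; first by exists g.
by move=> x y; rewrite -!dist_eq1 // -g_iso !fK.
Qed.

Lemma treeA_unique d (T : sgraph) : 7 <= d ->
  maximizes_wiener (d + 5) d T -> isomorphic T (treeA (d + 5)).
Proof.
move=> d7 [Td Tmax]; have d5 : 5 <= d by lia.
have [Ad Amax] := treeA_maximizes d5.
have WT : (wiener T).*2 = max_wiener2 d.
  rewrite -treeA_wiener //; congr _.*2; apply/eqP.
  by rewrite eqn_leq Amax // Tmax.
have [[_ conT _] cardT _] := Td; have [[_ conA _] cardA _] := Ad.
have [v [u1 [u2 [u3 [u4 [h [a [[_ v_geo u_geo] _ /(_ d7 WT)]]]]]]]] := tree_frame Td d5.
case=> [[h1 h2 h3 h4] [a1 a2 a3 a4] [D12 D34] [D13 D14 D23 D24]].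
(* The numbering of [treeA]: the path first, then [u1] to [u4], whose feet 1, 1, [d - 1], [d - 1]
   match [leaf_root]. *)
pose g i := nth (v 0) (map v (iota 0 d.+1) ++ [:: u1; u2; u3; u4]) i.
have g_path i : i <= d -> g i = v i.
  by move=> le_i; rewrite /g nth_cat size_map size_iota ltnS le_i (nth_map 0) ?size_iota ?nth_iota.
have g_leaf k : g (d.+1 + k) = nth (v 0) [:: u1; u2; u3; u4] k.
  by rewrite /g nth_cat size_map size_iota ltnNge leq_addr addKn.
have leaf i : d < i -> i < d + 5 -> exists2 k, k < 4 & i = d.+1 + k.
  by move=> lt_di lt_i; exists (i - d.+1); lia.
have rootE j (le_j : j <= d) := conj (leaf_height_path le_j) (leaf_root_path le_j).
have g_mixed i j : d < i -> i < d + 5 -> j <= d ->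
    dist (g i) (g j) = leaf_dist (leaf_height d) (leaf_root d) i j.
  move=> lt_di lt_i le_j; have [k lt_k Ei] := leaf i lt_di lt_i.
  rewrite (g_path j) // /leaf_dist; have [-> ->] := rootE j le_j.
  have -> : (i == j) = false by lia.
  rewrite Ei leaf_height_leaf leaf_root_leaf g_leaf.
  have uE u : u \in [:: u1; u2; u3; u4] -> dist u (v j) = h u + gap (a u) j.
    by case/u_geo=> _; apply.
  move: k lt_k {Ei} => [|[|[|[|//]]]] _ /=; rewrite uE ?inE ?eqxx ?orbT //.
  - by rewrite h1 a1.
  - by rewrite h2 a2.
  - by rewrite h3 a3.
  - by rewrite h4 a4.
have g_dist i j : i < d + 5 -> j < d + 5 ->
    dist (g i) (g j) = leaf_dist (leaf_height d) (leaf_root d) i j.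
  move=> lt_i lt_j; have [le_i|lt_di] := leqP i d; have [le_j|lt_dj] := leqP j d.
  - rewrite !g_path // v_geo // /leaf_dist.
    have [-> ->] := rootE i le_i; have [-> ->] := rootE j le_j.
    by rewrite /gap; case: eqP; lia.
  - by rewrite dist_sym // g_mixed // /leaf_dist eq_sym addnAC /gap; case: eqP => // _; lia.
  - exact: g_mixed.
  have [k lt_k Ei] := leaf i lt_di lt_i; have [l lt_l Ej] := leaf j lt_dj lt_j.
  rewrite /leaf_dist Ei Ej eqn_add2l !leaf_height_leaf !leaf_root_leaf !g_leaf.
  move: k l lt_k lt_l {Ei Ej} => [|[|[|[|//]]]] [|[|[|[|//]]]] _ _ /=;
  rewrite ?dist_refl // ?(dist_sym conT u2 u1) ?(dist_sym conT u3 u1) ?(dist_sym conT u4 u1)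
    ?(dist_sym conT u3 u2) ?(dist_sym conT u4 u2) ?(dist_sym conT u4 u3)
    ?D12 ?D13 ?D14 ?D23 ?D24 ?D34 /gap; clear -d7; lia.
apply: (@isomorphic_of_isometry T (treeA (d + 5)) (fun i : 'I_(d + 5) => g i)) => //.
  by rewrite cardT cardA.
move=> x y; rewrite g_dist //; apply/esym.
exact: (proj2 (explicit_dist (treeA_metric d5))).
Qed.

Theorem mainTheorem3 :
  [/\ [/\ maximizes_wiener 10 5 (treeA 10),
          maximizes_wiener 10 5 (treeB 10)
        & wiener (treeA 10) = wiener (treeB 10)],
      [/\ maximizes_wiener 11 6 (treeA 11),
          maximizes_wiener 11 6 (treeC 11)
        & wiener (treeA 11) = wiener (treeC 11)]
    & forall n : nat, 12 <= n ->
        maximizes_wiener n (n - 5) (treeA n) /\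
        forall T : sgraph, maximizes_wiener n (n - 5) T ->
          isomorphic T (treeA n)].
Proof.
have wiener_eq n d G G' : maximizes_wiener n d G -> maximizes_wiener n d G' ->
    wiener G = wiener G'.
  by move=> [Gd Gmax] [Gd' Gmax']; apply/eqP; rewrite eqn_leq Gmax // Gmax'.
have A10 := @treeA_maximizes 5 isT; have A11 := @treeA_maximizes 6 isT.
have B10 := treeB10_maximizes; have C11 := treeC11_maximizes.
split; [split=> //; exact: wiener_eq A10 B10|split=> //; exact: wiener_eq A11 C11|].
(* With [d = n - 5], the condition [12 <= n] is the threshold [7 <= d] of the equality case. *)
move=> n n12; have -> : n = (n - 5) + 5 by lia.
rewrite addnK; split; first by apply: treeA_maximizes; lia.
by move=> T; apply: treeA_unique; lia.
Qed.
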